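(* Let $p$ be a prime, $G$ a cyclic group of order $p$, and $L=\mathbb{Z}_pG$. For $n\ge 0$ let $b_n(L)$ denote the number of all $\mathbb{Z}_pG$-submodules of $L$ of index $p^n$, and let $Z(L;s)=\sum_{n\ge 0}b_n(L)p^{-ns}$. Then $$Z(L;s)=\frac{1-p^{-s}+p^{1-2s}}{(1-p^{-s})^2}.$$
   Context: $\mathbb{Z}_p$ is the ring of $p$-adic integers. The identity can be read as an identity of formal power series in $p^{-s}$ (equivalently, for complex $s$ with $\mathrm{Re}(s)>0$). *)

(* Defs.v *)
From HB Require Import structures.
From mathcomp Require Import all_boot all_order all_algebra all_fingroup all_solvable finmap.
From mathcomp Require Import all_classical all_reals all_analysis.
From mathcomp Require Import complex.

Set Implicit Arguments.
Unset Strict Implicit.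
Unset Printing Implicit Defensive.

Import Order.TTheory GRing.Theory Num.Theory.

Local Open Scope classical_set_scope.
Local Open Scope ring_scope.

(** * The ring of p-adic integers *)

(* The inverse limit of the rings Z/p^n: a p-adic integer is the sequence of
   its residues, each represented by its canonical representative. For p > 0
   the coherence condition also forces 0 <= x n < p ^ n.                      *)
Record padic (p : nat) := Padic {
  pres :> nat -> int;
  _ : `[< forall n, pres n = (pres n.+1 %% (p ^ n)%N%:Z)%Z >] }.

HB.instance Definition _ (p : nat) := [isSub for @pres p].
HB.instance Definition _ (p : nat) := [Choice of padic p by <:].

Section PadicRing.
Variable p : nat.
Implicit Types x y z : padic p.

Lemma padicE x n : x n = (x n.+1 %% (p ^ n)%N%:Z)%Z.
Proof. by case: x => f /= /asboolP. Qed.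

Lemma padic_mod x n : (x n %% (p ^ n)%N%:Z)%Z = x n.
Proof. by rewrite padicE modz_mod. Qed.

Lemma padicP x y : (forall n, x n = y n) -> x = y.
Proof. by move=> exy; apply/val_inj/funext. Qed.

Lemma mk_padic_subproof (f : nat -> int) :
    (forall n, (f n = f n.+1 %[mod (p ^ n)%N%:Z])%Z) ->
  `[< forall n, (f n %% (p ^ n)%N%:Z)%Z
        = ((f n.+1 %% (p ^ n.+1)%N%:Z)%Z %% (p ^ n)%N%:Z)%Z >].
Proof.
move=> cf; apply/asboolP => n; rewrite cf.
apply/eqP; rewrite eqz_mod_dvd {1}(divz_eq (f n.+1) (p ^ n.+1)%N) addrK.
by rewrite expnS PoszM mulrA dvdz_mull.
Qed.

Definition mk_padic f (cf : forall n, (f n = f n.+1 %[mod (p ^ n)%N%:Z])%Z) :=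
  Padic (mk_padic_subproof cf).

Lemma padicC_cong (c : int) n : (c = c %[mod (p ^ n)%N%:Z])%Z.
Proof. by []. Qed.

Lemma padicN_cong x n : (- x n = - x n.+1 %[mod (p ^ n)%N%:Z])%Z.
Proof. by rewrite [x n]padicE modzNm. Qed.

Lemma padicD_cong x y n :
  (x n + y n = x n.+1 + y n.+1 %[mod (p ^ n)%N%:Z])%Z.
Proof. by rewrite [x n]padicE [y n]padicE modzDm. Qed.

Lemma padicM_cong x y n :
  (x n * y n = x n.+1 * y n.+1 %[mod (p ^ n)%N%:Z])%Z.
Proof. by rewrite [x n]padicE [y n]padicE modzMm. Qed.

Definition padic0 := mk_padic (padicC_cong 0).
Definition padic1 := mk_padic (padicC_cong 1).
Definition padic_opp x := mk_padic (padicN_cong x).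
Definition padic_add x y := mk_padic (padicD_cong x y).
Definition padic_mul x y := mk_padic (padicM_cong x y).

Lemma padic_addA : associative padic_add.
Proof. by move=> x y z; apply: padicP => n /=; rewrite modzDml modzDmr addrA. Qed.

Lemma padic_addC : commutative padic_add.
Proof. by move=> x y; apply: padicP => n /=; rewrite addrC. Qed.

Lemma padic_add0 : left_id padic0 padic_add.
Proof. by move=> x; apply: padicP => n /=; rewrite mod0z add0r padic_mod. Qed.

Lemma padic_addN : left_inverse padic0 padic_opp padic_add.
Proof. by move=> x; apply: padicP => n /=; rewrite modzDml addNr. Qed.

HB.instance Definition _ := GRing.isZmodule.Build (padic p)
  padic_addA padic_addC padic_add0 padic_addN.

Lemma padic_mulA : associative padic_mul.
Proof. by move=> x y z; apply: padicP => n /=; rewrite modzMml modzMmr mulrA. Qed.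

Lemma padic_mulC : commutative padic_mul.
Proof. by move=> x y; apply: padicP => n /=; rewrite mulrC. Qed.

Lemma padic_mul1 : left_id padic1 padic_mul.
Proof. by move=> x; apply: padicP => n /=; rewrite modzMml mul1r padic_mod. Qed.

Lemma padic_mulD : left_distributive padic_mul +%R.
Proof.
by move=> x y z; apply: padicP => n /=; rewrite modzMml modzDm mulrDl.
Qed.

HB.instance Definition _ := GRing.Zmodule_isComPzRing.Build (padic p)
  padic_mulA padic_mulC padic_mul1 padic_mulD.

End PadicRing.

(** * The group ring of a finite group *)

Definition grpring (R : pzRingType) (G : finGroupType) := {ffun G -> R}.

HB.instance Definition _ (R : pzRingType) (G : finGroupType) :=
  GRing.Zmodule.on (grpring R G).

Section GroupRing.
Variables (R : pzRingType) (G : finGroupType).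
Implicit Types a b c : grpring R G.

Definition grpring1 : grpring R G := [ffun g => (g == 1%g)%:R].

Definition grpring_mul a b : grpring R G :=
  [ffun g => \sum_(h : G) a h * b (h^-1 * g)%g].

Lemma grpring_mulA : associative grpring_mul.
Proof.
move=> a b c; apply/ffunP => g; rewrite !ffunE.
under eq_bigr do rewrite ffunE big_distrr /=.
under [RHS]eq_bigr do rewrite ffunE big_distrl /=.
rewrite [RHS]exchange_big /=; apply: eq_bigr => h _.
rewrite [RHS](reindex_inj (mulgI h)) /=; apply: eq_bigr => k _.
by rewrite mulKg invMg !mulgA mulrA.
Qed.

Lemma grpring_mul1l : left_id grpring1 grpring_mul.
Proof.
move=> a; apply/ffunP => g; rewrite ffunE (bigD1 1%g) //= ffunE eqxx mul1r.
by rewrite invg1 mul1g big1 ?addr0 // => h /negPf; rewrite ffunE => ->; rewrite mul0r.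
Qed.

Lemma grpring_mul1r : right_id grpring1 grpring_mul.
Proof.
move=> a; apply/ffunP => g; rewrite ffunE (bigD1 g) //= ffunE mulVg eqxx mulr1.
rewrite big1 ?addr0 // => h /negPf hg; rewrite ffunE.
by rewrite -eq_mulVg1 hg mulr0.
Qed.

Lemma grpring_mulDl : left_distributive grpring_mul +%R.
Proof.
move=> a b c; apply/ffunP => g; rewrite !ffunE -big_split /=.
by apply: eq_bigr => h _; rewrite !ffunE mulrDl.
Qed.

Lemma grpring_mulDr : right_distributive grpring_mul +%R.
Proof.
move=> a b c; apply/ffunP => g; rewrite !ffunE -big_split /=.
by apply: eq_bigr => h _; rewrite !ffunE mulrDr.
Qed.

HB.instance Definition _ := GRing.Zmodule_isPzRing.Build (grpring R G)
  grpring_mulA grpring_mul1l grpring_mul1r grpring_mulDl grpring_mulDr.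

End GroupRing.

(** * Counting submodules of finite index *)

Definition has_index (V : zmodType) (N : set V) (k : nat) : Prop :=
  ([set [set x + y | y in N] | x in [set: V]] #= `I_k)%card.

Definition submods (A : pzRingType) (V : lmodType A) (k : nat) : set (set V) :=
  [set N : set V | GRing.submod_closed [in N] /\ has_index N k].
Arguments submods {A} V k.

(* This is the number of submodules of index k only when they are finitely
   many: fset_set sends an infinite set to the empty one.                     *)
Definition nsubmods (A : pzRingType) (V : lmodType A) (k : nat) : nat :=
  #|` fset_set (submods V k)|.

(** * Complex powers of a positive real *)

Definition cpow (R : realType) (x : R) (z : R[i]) : R[i] :=
  let: Complex a b := z in
  (x `^ a)%:C%C * (cos (b * ln x) +i* sin (b * ln x))%C.

(* Main.v *)
Require Import Defs.
From HB Require Import structures.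
From mathcomp Require Import all_boot all_order all_algebra all_fingroup all_solvable finmap.
From mathcomp Require Import all_classical all_reals all_analysis.
From mathcomp Require Import complex.
From mathcomp Require Import ring lra.

Set Implicit Arguments.
Unset Strict Implicit.
Unset Printing Implicit Defensive.

Import Order.TTheory GRing.Theory Num.Theory.
Import numFieldNormedType.Exports.

Local Open Scope classical_set_scope.
Local Open Scope ring_scope.

(** Let A be the group ring of G over the p-adic integers, T = x - 1 for a
    generator x of G, and N the sum of the elements of G.  A/TA is the ring of
    p-adic integers (augmentation), T N = 0, and the annihilator of T is A N.
    Submodules of A are ideals, and an ideal I of finite index is determined by
    its image in A/TA and by its intersection with TA.

    Such an I contains p^n A for some n ([has_index_exponent]), and an element
    of A whose augmentation is prime to p is invertible modulo p^n, because T^p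
    is divisible by p ([unit_mod]).  So the image of I is generated by some
    p^(a+1), unless I = A, and the intersection of I and TA is T^(m+1) A for
    some m.  Let u in I have augmentation p^(a+1).  Then T u lies in
    T^(m+1) A, so u - T^m y is killed by T for some y, which makes it a
    multiple of N.  Since T^m A / T^(m+1) A has p elements for m > 0, one gets
    I = (T^(m+1), j T^m + p^a N) with 0 <= j < p, where j = 0 if m = 0
    ([ideal_classification]).  These ideals are pairwise distinct ([idl_inj])
    and have index p^(a+m+1) ([index_idl]).  For a + m = n there are 1 + n p of
    them ([card_submods]), and only A itself has index 1.

    The two readings of the zeta function are then computations with the
    sequence 1, 1, 1 + p, 1 + 2 p, 1 + 3 p and so on: its second differences
    vanish except at the start ([zeta_coef]), and the partial sums have a closed
    form whose error term is a combination of t^n and n t^n ([zeta_cvg]). *)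

(** * Subgroups of finite index *)

Lemma card_eq_fin (F : finType) : ([set: F] #= `I_#|F|)%card.
Proof.
have -> : [set: F] = range (@enum_val F predT).
  by apply/seteqP; split=> // x _; exists (enum_rank x) => //; rewrite enum_rankK.
rewrite card_eq_sym; apply: (card_eq_trans card_II); rewrite card_eq_sym.
by apply: inj_card_eq => i j _ _; apply: enum_val_inj.
Qed.

Section Index.
Variable V : zmodType.
Implicit Types (M N : set V) (x y : V).

Definition subgroup N := N 0 /\ forall x y, N x -> N y -> N (x - y).

Lemma subgroupN N x : subgroup N -> N x -> N (- x).
Proof. by case=> N0 NB Nx; rewrite -sub0r; apply: NB. Qed.

Lemma subgroupD N x y : subgroup N -> N x -> N y -> N (x + y).
Proof. by move=> gN Nx Ny; rewrite -[y]opprK; apply: gN.2 => //; apply: subgroupN. Qed.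

Lemma subgroupC N x y : subgroup N -> N (x - y) -> N (y - x).
Proof. by move=> gN Nxy; rewrite -opprB; apply: subgroupN. Qed.

Lemma subgroup_trans N y x z : subgroup N -> N (x - y) -> N (y - z) -> N (x - z).
Proof. by move=> gN Nxy Nyz; rewrite -(subrKA y); apply: subgroupD. Qed.

Lemma coset_eqP N x y : subgroup N ->
  [set x + z | z in N] = [set y + z | z in N] <-> N (x - y).
Proof.
move=> gN; split=> [e|Nxy].
  have : [set x + z | z in N] x by exists 0; rewrite ?addr0 //; case: gN.
  by rewrite e => -[z Nz <-]; rewrite addrC addKr.
apply/seteqP; split=> _ [z Nz <-].
  by exists (x - y + z); [exact: (subgroupD gN Nxy Nz) | rewrite addrA subrKC].
exists (y - x + z); last by rewrite addrA subrKC.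
exact: (subgroupD gN (subgroupC gN Nxy) Nz).
Qed.

Definition coset_reps (F : finType) N (r : F -> V) :=
  (forall x, exists i, N (x - r i)) /\ (forall i j, N (r i - r j) -> i = j).

Lemma coset_reps_index (F : finType) N (r : F -> V) :
  subgroup N -> coset_reps N r -> has_index N #|F|.
Proof.
move=> gN [surr injr]; rewrite /has_index card_eq_sym.
apply: (card_eq_trans card_II).
have -> : [set [set x + y | y in N] | x in [set: V]] =
    [set [set r (enum_val i) + y | y in N] | i in [set: 'I_#|F|]].
  apply/seteqP; split=> _ [x _ <-]; last by exists (r (enum_val x)).
  have [i Ni] := surr x; exists (enum_rank i) => //.
  by apply/coset_eqP => //; rewrite enum_rankK; apply: subgroupC.
rewrite card_eq_sym; apply: inj_card_eq => i j _ _ /coset_eqP-/(_ gN)/injr.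
exact: enum_val_inj.
Qed.

Lemma index_coset_reps N k : subgroup N -> has_index N k ->
  exists r : 'I_k -> V, coset_reps N r.
Proof.
move=> gN; rewrite /has_index card_eq_sym => /card_set_bijP[f [f_fun f_inj f_surj]].
have /choice[r rE] (i : 'I_k) : exists x, [set x + y | y in N] = f i.
  by have [x _ ?] := f_fun i (ltn_ord i); exists x.
exists r; split=> [x|i j Nij].
  have [|i ik fi] := f_surj [set x + y | y in N]; first by exists x.
  by exists (Ordinal ik); apply/coset_eqP; rewrite // rE -fi.
apply/val_inj/f_inj; rewrite ?inE /=; [exact: ltn_ord..|].
by rewrite -!rE; apply/coset_eqP.
Qed.

Lemma has_index_uniq N k l : has_index N k -> has_index N l -> k = l.
Proof.
by rewrite /has_index card_eq_sym => Nk Nl; apply/card_eq_II/(card_eq_trans Nk Nl).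
Qed.

(** If N has index k and the elements t i represent the cosets of M in N, the
    sums r j + t i represent the cosets of M. *)
Lemma has_index_tower M N k (F : finType) (t : F -> V) :
    subgroup M -> subgroup N -> M `<=` N -> (forall i, N (t i)) ->
    (forall x, N x -> exists i, M (x - t i)) ->
    (forall i j, M (t i - t j) -> i = j) ->
  has_index N k -> has_index M (#|F| * k).
Proof.
move=> gM gN MN Nt surt injt /(index_coset_reps gN)[r [surr injr]].
rewrite -[X in (_ * X)%N]card_ord -card_prod.
apply: (@coset_reps_index _ _ (fun u => r u.2 + t u.1)) => //.
split=> [x|[i j] [i' j'] /=].
  have [j /surt[i Mij]] := surr x.
  by exists (i, j); rewrite /= opprD addrA.
rewrite opprD addrACA => Mij.
have ej : j = j'.
  apply: injr; rewrite -[_ - _](addrK (t i - t i')).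
  by apply: gN.2; [exact: MN | exact: gN.2].
by move: Mij; rewrite ej subrr add0r => /injt ->.
Qed.

(** Lagrange: translation by x permutes the cosets of N, so the sum of a set of
    representatives is unchanged modulo N when x is added to each of them. *)
Lemma has_index_exponent N k x : subgroup N -> has_index N k -> N (x *+ k).
Proof.
move=> gN /(index_coset_reps gN)[r [surr injr]].
have /choice[s sE] i : exists j, N (r i + x - r j) := surr (r i + x).
have s_inj : injective s.
  move=> i j eij; apply: injr; rewrite -(addrKA x) [x + _]addrC.
  by apply: (subgroup_trans gN (sE i)); rewrite eij; exact: subgroupC (sE j).
have : N (\sum_i (r i + x - r (s i))).
  by apply: (big_ind N) => [|u v|i _]; [by case: gN | exact: (subgroupD gN) | exact: sE].
rewrite sumrB big_split /= [X in X + _ - _](reindex_inj s_inj) /=.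
by rewrite sumr_const card_ord addrAC subrr add0r.
Qed.

End Index.

(** * Ideals of finite index in the group ring, abstractly *)

(** The properties of the group ring of a cyclic group of order p over the
    p-adic integers on which the count rests, with T = x - 1 and N the norm
    element.  The last three fields stand for the isomorphism of A/TA with the
    p-adic integers: approximation by natural numbers modulo p^k, no new
    divisibility between natural numbers, and absence of p-torsion. *)
Record fibre_ring (A : comPzRingType) (p : nat) (T N : A) : Prop := FibreRing {
  fr_TN : T * N = 0;
  fr_annT : forall x : A, T * x = 0 -> exists c, x = c * N;
  fr_N : exists v, N = p%:R + T * v;
  fr_Tp : exists w, T ^+ p = p%:R * w;
  fr_torsion : forall x : A, p%:R * x = 0 -> x = 0;
  fr_T_nmul : forall x, T <> p%:R * x;
  fr_digits : forall k x, exists i y z, x = i%:R + p%:R ^+ k * y + T * z;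
  fr_dvd : forall k i y z, i%:R = p%:R ^+ k * y + T * z -> (p ^ k %| i)%N;
  fr_quot : forall y z, p%:R * y = T * z -> exists z', y = T * z'
}.

Section Classification.
Variables (A : comPzRingType) (p : nat) (T N : A).
Hypotheses (p_pr : prime p) (AX : fibre_ring p T N).
Implicit Types (x y z : A) (I : set A).

Definition is_ideal I := I 0 /\ forall a x y, I x -> I y -> I (a * x + y).

Lemma ideal_subgroup I : is_ideal I -> subgroup I.
Proof.
by move=> [I0 IL]; split=> // x y Ix Iy; rewrite addrC -mulN1r; apply: IL.
Qed.

Lemma idealD I x y : is_ideal I -> I x -> I y -> I (x + y).
Proof. by move=> [_ IL] Ix Iy; rewrite -[x]mul1r; apply: IL. Qed.

Lemma idealB I x y : is_ideal I -> I x -> I y -> I (x - y).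
Proof. by move=> /ideal_subgroup[_]; apply. Qed.

Lemma idealM I a x : is_ideal I -> I x -> I (a * x).
Proof. by move=> [I0 IL] Ix; rewrite -[_ * _]addr0; apply: IL. Qed.

(** If N = p + T v, then T N = 0 reads p T = - T^2 v.  Hence p kills
    T^m A / T^(m+1) A for m > 0. *)
Lemma pT_TT : exists v, p%:R * T = T ^+ 2 * v.
Proof.
have [v Nv] := fr_N AX; exists (- v).
by have := fr_TN AX; rewrite Nv => e; rewrite -[LHS]subr0 -[in LHS]e; ring.
Qed.

(** TA and AN meet in 0, because N acts as 0 on the former and as p on the
    latter. *)
Lemma TT_reduced x : T * (T * x) = 0 -> T * x = 0.
Proof.
move=> /(fr_annT AX)[c xc]; have [v Nv] := fr_N AX.
rewrite xc; apply: (fr_torsion AX).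
have -> : p%:R * (c * N) = (T * x) * N - c * v * (T * N) by rewrite xc Nv; ring.
by rewrite mulrAC (fr_TN AX) !mul0r mulr0 subr0.
Qed.

Lemma TX_reduced m x : T ^+ m.+1 * x = 0 -> T * x = 0.
Proof.
elim: m x => [|m IH] x; first by rewrite expr1.
by rewrite exprSr -mulrA => /IH/TT_reduced.
Qed.

Lemma digits_lt k x :
  exists2 i, (i < p ^ k)%N & exists y z, x = i%:R + p%:R ^+ k * y + T * z.
Proof.
have [i [y [z ->]]] := fr_digits AX k x.
exists (i %% p ^ k)%N; first by rewrite ltn_mod expn_gt0 prime_gt0.
exists (y + (i %/ p ^ k)%:R), z.
by rewrite {1}(divn_eq i (p ^ k)) natrD natrM natrX; ring.
Qed.

Lemma TX_digit m x : exists2 i, (i < p)%N &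
  exists y, T ^+ m.+1 * x = i%:R * T ^+ m.+1 + T ^+ m.+2 * y.
Proof.
have [i ip [y [z ->]]] := digits_lt 1 x; have [v pT] := pT_TT.
exists i => //; exists (v * y + z).
have -> : T ^+ m.+1 * (i%:R + p%:R ^+ 1 * y + T * z) =
  i%:R * T ^+ m.+1 + (p%:R * T) * T ^+ m * y + T ^+ m.+2 * z by rewrite !exprS; ring.
by rewrite pT !exprS; ring.
Qed.

(** T^m A / T^(m+1) A has p elements for m > 0, not fewer: the equation says
    that i - T y is killed by a power of T, hence by T, so i - T y = c N, and
    c N is a multiple of p modulo T. *)
Lemma TX_digit_eq0 m i y : i%:R * T ^+ m.+1 = T ^+ m.+2 * y -> (p %| i)%N.
Proof.
move=> e; have /TX_reduced/(fr_annT AX)[c ec] : T ^+ m.+1 * (i%:R - T * y) = 0.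
  by rewrite mulrBr mulrC e !exprS; ring.
have [v Nv] := fr_N AX.
apply: (fr_dvd (k := 1) AX (y := c) (z := y + c * v)).
by rewrite -[LHS](subrK (T * y)) ec Nv; ring.
Qed.

Lemma multiples_inj k I u : is_ideal I -> (forall d, I (d%:R * u) -> (k %| d)%N) ->
  forall i j : 'I_k, I (i%:R * u - j%:R * u) -> i = j.
Proof.
move=> /ideal_subgroup gI dvd i j.
wlog ij : i j / (i <= j)%N => [W|].
  case/orP: (leq_total i j) => ij; first exact: W.
  by move=> /(subgroupC gI)/W->.
move=> /(subgroupC gI); rewrite -mulrBl -natrB // => /dvd d; apply/val_inj/eqP.
rewrite eqn_leq ij -subn_eq0; apply: contraLR d; rewrite -lt0n => d.
by rewrite gtnNdvd // (leq_ltn_trans (leq_subr _ _)).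
Qed.

Lemma torsionX k x : p%:R ^+ k * x = 0 -> x = 0.
Proof.
elim: k => [|k IH]; first by rewrite mul1r.
by rewrite exprS -mulrA => /(fr_torsion AX).
Qed.

Lemma quotX k y z : p%:R ^+ k * y = T * z -> exists z', y = T * z'.
Proof.
elim: k z => [|k IH] z; first by rewrite mul1r => ->; exists z.
by rewrite exprS -mulrA => /(fr_quot AX)[z' /IH].
Qed.

(** Newton step: 1 - x w'' = (1 - x w) (1 - x w') for w'' = w + w' - x w w'. *)
Lemma unit_lift x w e n : x * w = 1 + p%:R * e ->
  exists w' e', x * w' = 1 + p%:R ^+ n * e'.
Proof.
move=> xw; elim: n => [|n [w' [e' xw']]]; first by exists 0, (-1); ring.
exists (w + w' - x * w * w'), (- (e * e')).
rewrite exprS.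
have -> : x * (w + w' - x * w * w') = 1 - (1 - x * w) * (1 - x * w') by ring.
by rewrite xw xw'; ring.
Qed.

(** A is local with residue field of order p.  The inverse modulo p comes from
    i^p - (- T z)^p, a multiple of i + T z which is i^p modulo p because p
    divides T^p. *)
Lemma unit_mod n i y z : coprime p i ->
  exists w e, (i%:R + p%:R * y + T * z) * w = 1 + p%:R ^+ n * e.
Proof.
move=> cpi; have [w0 Tp] := fr_Tp AX.
have ip_gt0 : (0 < i ^ p)%N.
  rewrite expn_gt0; case: i cpi => //.
  by rewrite /coprime gcdn0 => /eqP p1; move: p_pr; rewrite p1.
have cpip : coprime (i ^ p) p by rewrite coprime_sym coprimeXr.
case: (egcdnP p ip_gt0) => a b ab _; rewrite (eqP cpip) in ab.
have [s xs] : exists s, (i%:R + T * z) * s = i%:R ^+ p - p%:R * (w0 * (- z) ^+ p).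
  have := subrXX i%:R (- (T * z)) p; rewrite opprK -mulrN exprMn Tp -mulrA => e.
  by eexists; symmetry; exact: e.
have ab' : a%:R * i%:R ^+ p = 1 + p%:R * b%:R :> A.
  by rewrite -natrX -!natrM ab natrD mulnC addrC.
apply: (@unit_lift _ (a%:R * s) (b%:R - a%:R * w0 * (- z) ^+ p + y * a%:R * s)).
have -> : (i%:R + p%:R * y + T * z) * (a%:R * s) =
  a%:R * ((i%:R + T * z) * s) + p%:R * (y * a%:R * s) by ring.
have -> : a%:R * ((i%:R + T * z) * s) =
  a%:R * i%:R ^+ p - p%:R * (a%:R * w0 * (- z) ^+ p) by rewrite xs; ring.
by rewrite ab'; ring.
Qed.

(** The ideal generated by T^(m+1) and j T^m + p^a N. *)
Definition idl m (j : nat) a : set A :=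
  [set x | exists y z, x = T ^+ m.+1 * y + (j%:R * T ^+ m + p%:R ^+ a * N) * z].

Lemma idl_ideal m j a : is_ideal (idl m j a).
Proof.
split=> [|c _ _ [y [z ->]] [y' [z' ->]]]; first by exists 0, 0; ring.
by exists (c * y + y'), (c * z + z'); ring.
Qed.

Lemma idl_T m j a y : idl m j a (T ^+ m.+1 * y).
Proof. by exists y, 0; ring. Qed.

Lemma idl_gen m j a z : idl m j a ((j%:R * T ^+ m + p%:R ^+ a * N) * z).
Proof. by exists 0, z; ring. Qed.

(** The augmentation of j T^0 is j, so for m = 0 only j = 0 keeps the second
    generator at augmentation p^(a+1). *)
Definition admissible m (j : nat) := m = 0%N -> j = 0%N.

Lemma admissibleT m j : admissible m j -> exists s, j%:R * T ^+ m = T * s :> A.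
Proof.
case: m => [|m] adm; first by exists 0; rewrite adm //; ring.
by exists (j%:R * T ^+ m); rewrite exprS; ring.
Qed.

(** The second generator has augmentation p^(a+1). *)
Lemma genE m j a : admissible m j ->
  exists s, j%:R * T ^+ m + p%:R ^+ a * N = p%:R ^+ a.+1 + T * s.
Proof.
move=> /admissibleT[s ->]; have [v ->] := fr_N AX.
by exists (s + p%:R ^+ a * v); rewrite exprS; ring.
Qed.

(** The second generator has nonzero augmentation, so a combination with zero
    augmentation uses it with a coefficient in TA, and T times it is a multiple
    of T^(m+1). *)
Lemma idl_capT m j a z : admissible m j -> idl m j a (T * z) ->
  exists y, T * z = T ^+ m.+1 * y.
Proof.
move=> adm [y [c e]]; have [s gE] := genE a adm.
have /quotX[c' cE] : p%:R ^+ a.+1 * c = T * (z - T ^+ m * y - s * c).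
  have -> : p%:R ^+ a.+1 * c = (p%:R ^+ a.+1 + T * s) * c - T * s * c by ring.
  by rewrite -gE -[_ * c](addKr (T ^+ m.+1 * y)) -e exprS; ring.
exists (y + j%:R * c'); rewrite e cE exprS.
have -> : (j%:R * T ^+ m + p%:R ^+ a * N) * (T * c') =
  T * T ^+ m * (j%:R * c') + p%:R ^+ a * (T * N) * c' by ring.
by rewrite (fr_TN AX); ring.
Qed.

Lemma idl0P a x : idl 0 0 a x <-> exists y z, x = p%:R ^+ a.+1 * y + T * z.
Proof.
have [|s gE] := @genE 0 0 a; first by [].
split=> -[y [z ->]].
  by exists z, (y + s * z); rewrite gE expr1; ring.
by exists (z - s * y), y; rewrite gE expr1; ring.
Qed.

Lemma index_idl0 a : has_index (idl 0 0 a) (p ^ a.+1).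
Proof.
rewrite -[(p ^ _)%N]card_ord.
apply: (@coset_reps_index _ _ _ (fun i : 'I_(p ^ a.+1) => i%:R)).
  exact/ideal_subgroup/idl_ideal.
split=> [x|i j].
  have [i ip [y [z ->]]] := digits_lt a.+1 x; exists (Ordinal ip).
  by apply/idl0P; exists y, z => /=; ring.
rewrite -[i%:R]mulr1 -[j%:R]mulr1; apply: multiples_inj => [|d].
  exact: idl_ideal.
by move=> /idl0P[y [z]]; rewrite mulr1; apply: (fr_dvd AX).
Qed.

(** Induction on m: idl m.+1 j a has index p in idl m 0 a, the multiples
    i T^(m+1) with i < p representing the cosets. *)
Lemma index_idl m j a : admissible m j -> has_index (idl m j a) (p ^ (a + m).+1).
Proof.
elim: m j => [|m IH] j adm; first by rewrite adm // addn0; apply: index_idl0.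
have admm : admissible m 0 by [].
have gI m' j' := ideal_subgroup (idl_ideal m' j' a).
rewrite addnS expnS -[X in (X * _)%N]card_ord.
apply: (@has_index_tower _ _ (idl m 0 a) _ _ (fun i : 'I_p => i%:R * T ^+ m.+1)) => //.
- move=> _ [y [z ->]]; exists (T * y + j%:R * z), z; rewrite !exprS; ring.
- by move=> i; rewrite mulrC; apply: idl_T.
- move=> _ [y [z ->]]; have [i ip [y' E]] := TX_digit m (y - j%:R * z).
  exists (Ordinal ip); exists y', z; rewrite /= mul0r add0r.
  have -> : T ^+ m.+1 * y + p%:R ^+ a * N * z = T ^+ m.+1 * (y - j%:R * z) +
    (j%:R * T ^+ m.+1 + p%:R ^+ a * N) * z by ring.
  by rewrite E; ring.
- apply: multiples_inj => [|d]; first exact: idl_ideal.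
  rewrite exprS mulrCA => /(idl_capT adm)[y].
  by rewrite mulrCA -exprS => /TX_digit_eq0.
exact: IH.
Qed.

(** a is the least exponent such that I contains an element of augmentation
    p^(a+1), and m + 1 is the largest exponent such that the intersection of I
    and TA is contained in T^(m+1) A. *)
Lemma ideal_classification n I :
    is_ideal I -> (forall x, I (p%:R ^+ n * x)) -> ~ I 1 ->
  exists m j a, [/\ admissible m j, (j < p)%N & I = idl m j a].
Proof.
move=> idI In I1.
have exP : exists k, `[< exists z, I (p%:R ^+ k + T * z) >].
  by exists n; apply/asboolP; exists 0; rewrite mulr0 addr0 -[_ ^+ n]mulr1.
case: (ex_minnP exP) => -[|a] /asboolP[z0 Iu] amin.
  case: I1; have [w [e we]] := unit_mod n 0 z0 (coprimen1 p).
  rewrite -[1](addrK (p%:R ^+ n * e)) -we mulrC; apply: idealB => //.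
  by apply: idealM => //; rewrite mulr0 addr0.
(* The gcd p^e of p^n and of the constant term of x is the augmentation of an
   element of I, whence a + 1 <= e by minimality. *)
have Ia x : I x -> exists y z, x = p%:R ^+ a.+1 * y + T * z.
  move=> Ix; have [i [y [z xE]]] := fr_digits AX n x.
  have an : (a.+1 <= n)%N.
    by apply: amin; apply/asboolP; exists 0; rewrite mulr0 addr0 -[_ ^+ n]mulr1.
  suff /dvdnP[k ik] : (p ^ a.+1 %| i)%N.
    exists (k%:R + p%:R ^+ (n - a.+1) * y), z.
    by rewrite xE ik natrM natrX -{1}(subnKC an) exprD; ring.
  have [->|i_gt0] := posnP i; first exact: dvdn0.
  case: (egcdnP (p ^ n) i_gt0) => u v uv _.
  have /(dvdn_pfactor _ _ p_pr)[e en ge] := dvdn_gcdr i (p ^ n).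
  rewrite ge in uv; apply: dvdn_trans (dvdn_gcdl i (p ^ n)); rewrite ge dvdn_exp2l //.
  apply: amin; apply/asboolP; exists (u%:R * z).
  have -> : p%:R ^+ e + T * (u%:R * z) = u%:R * x - p%:R ^+ n * (v%:R + u%:R * y).
    have := congr1 (fun k => k%:R : A) uv; rewrite natrD !natrM !natrX => uv'.
    have -> : p%:R ^+ e = u%:R * i%:R - v%:R * p%:R ^+ n :> A by rewrite uv'; ring.
    by rewrite xE; ring.
  by apply: idealB; first [exact: idI | exact: In | exact: idealM].
have exQ : exists k, ~~ `[< forall z, I (T * z) -> exists y, T * z = T ^+ k.+1 * y >].
  (* p^n T lies in I; if it were in T^(p(n+1)+1) A, hence in p^(n+1) A, then p
     would divide T. *)
  exists (p * n.+1)%N; apply/asboolPn => Q.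
  have [|y e] := Q (p%:R ^+ n); first by rewrite mulrC; apply: In.
  have [w Tp] := fr_Tp AX; apply: (fr_T_nmul AX (x := T * w ^+ n.+1 * y)).
  apply/subr0_eq/(torsionX (k := n)).
  have := subrr (T * p%:R ^+ n); rewrite {2}[T * _]e exprS exprM Tp exprMn exprS => <-.
  by ring.
case: (ex_minnP exQ) => -[/asboolPn[]|m]; first by move=> z; exists z; rewrite expr1.
move=> /asboolPn/existsNP[z1 /not_implyP[Iz1 z1N]] mmin.
have IT : forall z, I (T * z) -> exists y, T * z = T ^+ m.+1 * y.
  by apply/asboolP/negPn/negP => /mmin; rewrite ltnn.
(* By maximality some T z1 = T^(m+1) w in I is not in T^(m+2) A; then w is a
   unit modulo p^n. *)
have Im y : I (T ^+ m.+1 * y).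
  rewrite mulrC; apply: idealM => //; have [w z1E] := IT _ Iz1.
  have [i [y1 [z2 wE]]] := fr_digits AX 1 w; rewrite expr1 in wE.
  have [pi|pNi] := boolP (p %| i)%N.
    case: z1N; have [v pT] := pT_TT; case/dvdnP: pi => k ik.
    exists (v * (k%:R + y1) + z2).
    have -> : T * z1 = (p%:R * T) * T ^+ m * (k%:R + y1) + T ^+ m.+2 * z2.
      by rewrite z1E wE ik natrM !exprS; ring.
    by rewrite pT !exprS; ring.
  have [w' [e we]] := unit_mod n y1 z2 (etrans (prime_coprime i p_pr) pNi).
  have -> : T ^+ m.+1 = w' * (T * z1) - p%:R ^+ n * (T ^+ m.+1 * e).
    have -> : w' * (T * z1) = T ^+ m.+1 * (w * w') by rewrite z1E; ring.
    by rewrite wE we; ring.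
  by apply: idealB; first [exact: idI | exact: In | exact: idealM].
(* T kills T z0 + p^(a+1) - T^m y for some y, so this is c N, and c = p^a
   modulo T when m > 0.  Modulo T^(m+1) A, T^m y is j T^m for some j < p. *)
have [j [jp adm Ig]] : exists j, [/\ (j < p)%N, admissible m j &
    I (j%:R * T ^+ m + p%:R ^+ a * N)].
  have [v Nv] := fr_N AX.
  case: (m) IT Im {mmin z1N} => [|m'] IT Im.
    exists 0%N; split=> //; first exact: prime_gt0.
    have -> : 0%:R * T ^+ 0 + p%:R ^+ a * N =
        (p%:R ^+ a.+1 + T * z0) + T ^+ 1 * (p%:R ^+ a * v - z0).
      by rewrite Nv !exprS; ring.
    exact: idealD.
  have [|y yE] := IT (p%:R ^+ a.+1 + T * z0); first exact: idealM.
  have /(fr_annT AX)[c cE] : T * (p%:R ^+ a.+1 + T * z0 - T ^+ m'.+1 * y) = 0.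
    by rewrite mulrBr yE !exprS; ring.
  have [j jp [y' yE']] := TX_digit m' y; exists j; split => //.
  have [c' cE'] : exists c', c - p%:R ^+ a = T * c'.
    apply: (fr_quot AX (z := z0 - T ^+ m' * y - c * v)).
    have -> : p%:R * (c - p%:R ^+ a) = c * N - c * T * v - p%:R ^+ a.+1.
      by rewrite Nv exprS; ring.
    by rewrite -cE !exprS; ring.
  have -> : j%:R * T ^+ m'.+1 + p%:R ^+ a * N =
      (p%:R ^+ a.+1 + T * z0) - T ^+ m'.+2 * y'.
    have -> : p%:R ^+ a.+1 + T * z0 = T ^+ m'.+1 * y + c * N by rewrite -cE; ring.
    have -> : c * N = p%:R ^+ a * N.
      by apply/subr0_eq; rewrite -mulrBl cE' mulrAC (fr_TN AX) mul0r.
    by rewrite yE'; ring.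
  exact: idealB.
exists m, j, a; split => //; apply/seteqP; split=> [x Ix|_ [y [z ->]]].
  have [y [z xE]] := Ia x Ix; have [s gE] := genE a adm.
  have xE' : x - y * (j%:R * T ^+ m + p%:R ^+ a * N) = T * (z - s * y).
    by rewrite xE gE; ring.
  have [|y' E] := IT (z - s * y).
    by rewrite -xE'; apply: idealB => //; apply: idealM.
  by exists y', y; rewrite -E -xE'; ring.
by apply: idealD => //; rewrite mulrC; apply: idealM.
Qed.

(** The augmentations of the elements of idl m j a are the multiples of
    p^(a+1). *)
Lemma idl_le m j a m' j' a' : admissible m j -> admissible m' j' ->
  idl m j a `<=` idl m' j' a' -> (a' <= a)%N.
Proof.
move=> adm adm' sub; have [y [z]] := sub _ (idl_gen m j a 1).
have [s ->] := genE a adm; have [s' ->] := genE a' adm' => e.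
have : (p ^ a'.+1 %| p ^ a.+1)%N.
  apply: (fr_dvd AX (y := z) (z := T ^+ m' * y + s' * z - s)).
  by rewrite natrX -[LHS](addrK (T * s)) -[LHS in LHS + _]mulr1 e !exprS; ring.
by rewrite dvdn_Pexp2l ?prime_gt1.
Qed.

(** The augmentation recovers a, hence m; for m > 0, (j - j') T^m then
    lies in the intersection of the ideal with TA, that is in T^(m+1) A. *)
Lemma idl_inj m j a m' j' a' : admissible m j -> admissible m' j' ->
  (j < p)%N -> (j' < p)%N -> (a + m = a' + m')%N ->
  idl m j a = idl m' j' a' -> m = m' /\ j = j'.
Proof.
move=> adm adm' jp j'p s e.
have ea : a = a'.
  by apply/eqP; rewrite eqn_leq (idl_le adm' adm) ?(idl_le adm adm') // e.
have em : m = m' by apply/eqP; rewrite -(eqn_add2l a) s ea.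
split=> //; rewrite -{}em -{}ea in adm' e *.
case: m adm adm' e {s} => [-> // -> //|m] adm adm' e.
suff : Ordinal jp = Ordinal j'p by case.
apply: (multiples_inj (I := idl m.+1 j a) (u := T ^+ m.+1)) => [|d|/=].
- exact: idl_ideal.
- rewrite exprS mulrCA => /(idl_capT adm)[y].
  by rewrite mulrCA -exprS => /TX_digit_eq0.
- rewrite -[_ - _](addrKA (p%:R ^+ a * N)) [p%:R ^+ a * N + _]addrC.
  apply: idealB; first exact: idl_ideal.
    by rewrite -[X in idl _ _ _ X]mulr1; apply: idl_gen.
  by rewrite e -[X in idl _ _ _ X]mulr1; apply: idl_gen.
Qed.

Lemma submodsE k : submods (A^o : lmodType A) k = [set I | is_ideal I /\ has_index I k].
Proof.
rewrite /submods; congr [set _ | _]; apply/funext => I /=.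
rewrite /GRing.submod_closed inE; apply/propext.
split=> -[[I0 IL] Ik]; split=> //; split=> //.
  by move=> a x y Ix Iy; have := IL a x y; rewrite !inE; apply.
by move=> a x y; rewrite !inE; apply: IL.
Qed.

Lemma submods1 : submods (A^o : lmodType A) 1 = [set setT].
Proof.
rewrite submodsE; apply/seteqP; split=> [I [idI Ik]|_ ->] /=.
  apply/seteqP; split=> // x _; rewrite -[x]mulr1n.
  by apply: has_index_exponent Ik; apply: ideal_subgroup.
split=> //; rewrite -card_unit; apply: (@coset_reps_index _ _ _ (fun=> 0)) => //.
by split=> [x|[] []//]; exists tt.
Qed.

Definition idl_of n (u : option ('I_n * 'I_p)) : set A :=
  if u is Some (i, j) then idl i.+1 j (n - i.+1) else idl 0 0 n.

(** The admissible (m, j, a) with a + m = n are (0, 0, n) and the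
    (i + 1, j, n - i - 1) with i < n and j < p. *)
Lemma card_submods n :
  (submods (A^o : lmodType A) (p ^ n.+1) #= `I_(n * p).+1)%card.
Proof.
have -> : submods (A^o : lmodType A) (p ^ n.+1) = range (@idl_of n).
  rewrite submodsE; apply/seteqP; split=> [I [idI Ik]|_ [[[i j]|] _ <-]] /=; last 2 first.
  - split; first exact: idl_ideal.
    by rewrite -[in (p ^ _)%N](subnK (ltn_ord i)); apply: index_idl.
  - split; first exact: idl_ideal.
    by rewrite -[in (p ^ _)%N](addn0 n); apply: index_idl.
  have [||m [j [a [adm jp IE]]]] := @ideal_classification n.+1 I idI.
  - move=> x; rewrite -natrX mulr_natl.
    by apply: has_index_exponent Ik; apply: ideal_subgroup.
  - move=> I1; have IT : I = setT.
      by apply/seteqP; split=> // x _; rewrite -[x]mulr1; apply: idealM.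
    have : submods (A^o : lmodType A) 1 I by rewrite submods1.
    rewrite submodsE => -[_ I_1]; have /eqP := has_index_uniq Ik I_1.
    by rewrite expnS muln_eq1 => /andP[/eqP p1]; move: p_pr; rewrite p1.
  have mn : (a + m = n)%N.
    have := index_idl a adm; rewrite -IE => /(has_index_uniq Ik)/eqP.
    by rewrite eqn_exp2l ?prime_gt1 // => /eqP[].
  case: m adm IE mn => [|m] adm IE mn.
    by exists None => //=; rewrite IE adm // -mn addn0.
  have mn' : (m < n)%N by rewrite -mn leq_addl.
  by exists (Some (Ordinal mn', Ordinal jp)) => //=; rewrite IE -mn addnK.
have inj : injective (@idl_of n).
  move=> [[i j]|] [[i' j']|] //= /idl_inj E.
  - have [|||||[/val_inj ->] /val_inj -> //] := E; rewrite ?ltn_ord //.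
    by rewrite !subnK.
  - by have [|||||] // := E; rewrite ?prime_gt0 // subnK ?addn0.
  - by have [|||||] // := E; rewrite ?prime_gt0 // subnK ?addn0.
apply: (card_eq_trans (inj_card_eq (in2W inj))).
have -> : (n * p).+1 = #|{: option ('I_n * 'I_p)}|.
  by rewrite card_option card_prod !card_ord.
exact: card_eq_fin.
Qed.

End Classification.

(** * The p-adic integers *)

Section Padic.
Variable p : nat.
Hypothesis p_pr : prime p.
Implicit Types x y c : padic p.

Lemma padic_natE i n : (i%:R : padic p) n = (i%:Z %% (p ^ n)%N%:Z)%Z.
Proof.
elim: i => [|i IH]; first by [].
by rewrite -natr1 /= IH modzDm -PoszD addn1.
Qed.

Lemma padic_mulE x y n : (x * y) n = ((x n * y n)%R %% (p ^ n)%N%:Z)%Z.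
Proof. by []. Qed.

Lemma padic_mulXE k c n :
  (p%:R ^+ k * c : padic p) n = (((p ^ k)%N%:Z * c n)%R %% (p ^ n)%N%:Z)%Z.
Proof. by rewrite -natrX padic_mulE padic_natE modzMml. Qed.

Lemma padic_nat_dvd k i c : i%:R = p%:R ^+ k * c -> (p ^ k %| i)%N.
Proof.
move=> e; have : (i%:R : padic p) k = (p%:R ^+ k * c : padic p) k by rewrite e.
by rewrite padic_natE padic_mulXE modzMr => /dvdz_mod0P.
Qed.

Lemma padic0E n : (0 : padic p) n = 0.
Proof. exact: mod0z. Qed.

Lemma padic_torsion c : p%:R * c = 0 -> c = 0.
Proof.
move=> pc; apply: padicP => n; rewrite padicE padic0E.
have : (p%:R ^+ 1 * c : padic p) n.+1 = 0 by rewrite expr1 pc padic0E.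
rewrite padic_mulXE expn1 expnS PoszM => /dvdz_mod0P.
have p0 : p%:Z != 0 by rewrite eqz_nat -lt0n prime_gt0.
by rewrite dvdz_mul2l // => /dvdz_mod0P.
Qed.

Lemma padic_red x m n : (x (m + n)%N %% (p ^ n)%N%:Z)%Z = x n.
Proof.
elim: m => [|m IH]; first exact: padic_mod.
rewrite -[RHS]IH [x (m + n)%N]padicE.
apply/eqP; rewrite eqz_mod_dvd {1}(divz_eq (x _) (p ^ (m + n))%N) addrK.
by rewrite expnD PoszM mulrA dvdz_mull.
Qed.

(** c is the sequence of the quotients by p^k of the differences between the
    residues of x at levels n + k and k. *)
Lemma padic_digits k x : exists i c, x = i%:R + p%:R ^+ k * c.
Proof.
have pk n : (p ^ n)%N%:Z != 0 by rewrite eqz_nat -lt0n expn_gt0 prime_gt0.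
have /choice[e eE] n : exists e, x (n + k)%N = x k + (p ^ k)%N%:Z * e.
  have : ((p ^ k)%N%:Z %| x (n + k)%N - x k)%Z.
    by rewrite -eqz_mod_dvd padic_red padic_mod.
  by move=> /dvdzP[e xe]; exists e; rewrite mulrC -xe subrKC.
have cg n : (e n = e n.+1 %[mod (p ^ n)%N%:Z])%Z.
  apply/eqP; rewrite eqz_mod_dvd -(dvdz_mul2l (pk k)) mulrBr -PoszM -expnD.
  have -> : (p ^ k)%N%:Z * e n - (p ^ k)%N%:Z * e n.+1 = x (k + n)%N - x (1 + (k + n))%N.
    by rewrite add1n -addnS ![(k + _)%N]addnC !eE; ring.
  by rewrite -eqz_mod_dvd padic_mod padic_red.
exists `|x k|%N, (mk_padic cg); apply: padicP => n.
have xk0 : 0 <= x k by rewrite -padic_mod modz_ge0.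
rewrite -[LHS](padic_red x k) addnC eE.
have -> : forall y z : padic p, (y + z) n = ((y n + z n)%R %% (p ^ n)%N%:Z)%Z by [].
by rewrite padic_natE padic_mulXE modzDm gez0_abs // -[RHS]modzDmr modzMmr modzDmr.
Qed.

End Padic.

(** * The group ring of a cyclic group *)

Section GroupRing.
Variables (R : comPzRingType) (G : finGroupType).
Implicit Types (a b : grpring R G) (g h : G) (c : R).

Definition aug a : R := \sum_g a g.
Definition gelt g : grpring R G := [ffun h => (h == g)%:R].
Definition gcst c : grpring R G := [ffun h => c * (h == 1%g)%:R].

Lemma gelt_mulE g a h : (gelt g * a) h = a (g^-1 * h)%g.
Proof.
rewrite ffunE (bigD1 g) //= ffunE eqxx mul1r big1 ?addr0 // => k /negPf kg.
by rewrite ffunE kg mul0r.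
Qed.

Lemma gcst_mulE c a h : (gcst c * a) h = c * a h.
Proof.
rewrite ffunE (bigD1 1%g) //= ffunE eqxx mulr1 invg1 mul1g big1 ?addr0 // => k /negPf kg.
by rewrite ffunE kg mulr0 mul0r.
Qed.

Lemma gcst_comm c a : gcst c * a = a * gcst c.
Proof.
apply/ffunP => h; rewrite gcst_mulE ffunE (bigD1 h) //= ffunE mulVg eqxx mulr1.
rewrite big1 ?addr0 1?mulrC // => k /negPf kh.
by rewrite ffunE -eq_mulVg1 kh !mulr0.
Qed.

Lemma gelt1 : gelt 1 = 1. Proof. by []. Qed.

Lemma geltM g h : gelt (g * h) = gelt g * gelt h.
Proof.
by apply/ffunP => k; rewrite gelt_mulE !ffunE -[in RHS](inj_eq (mulgI g)) mulKVg.
Qed.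

Lemma geltX g n : gelt (g ^+ n) = gelt g ^+ n.
Proof. by elim: n => // n IH; rewrite expgS geltM IH exprS. Qed.

Lemma gcst_natE n : gcst n%:R = n%:R.
Proof.
apply/ffunP => h; rewrite ffunE -[n%:R in RHS]/(1 *+ n) ffunMnE.
by rewrite ffunE mulr_natl.
Qed.

Lemma gcstD c d : gcst (c + d) = gcst c + gcst d.
Proof. by apply/ffunP => h; rewrite !ffunE mulrDl. Qed.

Lemma gcstM c d : gcst (c * d) = gcst c * gcst d.
Proof. by apply/ffunP => h; rewrite gcst_mulE !ffunE mulrA. Qed.

Lemma augD a b : aug (a + b) = aug a + aug b.
Proof. by rewrite -big_split; apply: eq_bigr => g _; rewrite ffunE. Qed.

Lemma augM a b : aug (a * b) = aug a * aug b.
Proof.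
rewrite /aug big_distrl /=; under eq_bigr do rewrite ffunE.
rewrite exchange_big; apply: eq_bigr => h _ /=; rewrite big_distrr /=.
by rewrite (reindex_inj (mulgI h)); apply: eq_bigr => g _; rewrite mulKg.
Qed.

Lemma aug_gcst c : aug (gcst c) = c.
Proof.
rewrite /aug (bigD1 1%g) //= ffunE eqxx mulr1 big1 ?addr0 // => g /negPf g1.
by rewrite ffunE g1 mulr0.
Qed.

Lemma aug_gelt g : aug (gelt g) = 1.
Proof.
rewrite /aug (bigD1 g) //= ffunE eqxx big1 ?addr0 // => h /negPf hg.
by rewrite ffunE hg.
Qed.

Lemma aug_nat n : aug n%:R = n%:R.
Proof. by rewrite -gcst_natE aug_gcst. Qed.

Lemma grpringE a : a = \sum_g gcst (a g) * gelt g.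
Proof.
apply/ffunP => h; rewrite sum_ffunE (bigD1 h) //= gcst_mulE ffunE eqxx mulr1.
rewrite big1 ?addr0 // => g /negPf gh.
by rewrite gcst_mulE ffunE eq_sym gh mulr0.
Qed.

Lemma grpring_mulC : abelian [set: G]%SET -> commutative (@GRing.mul (grpring R G)).
Proof.
move=> /centsP cG a b; apply/ffunP => g; rewrite !ffunE.
rewrite (reindex_inj (inj_comp (mulIg g) invg_inj)) /=; apply: eq_bigr => h _.
by rewrite invMg invgK -mulgA (cG h (finset.in_setT h) g (finset.in_setT g)) mulKg mulrC.
Qed.

(** In the binomial expansion of (1 + T)^p all the terms other than 1 and T^p are
    divisible by p. *)
Lemma unipotent_expp (A : comPzRingType) (p : nat) (T : A) :
  prime p -> (1 + T) ^+ p = 1 -> exists w, T ^+ p = p%:R * w.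
Proof.
move=> p_pr; rewrite exprDn; case: p p_pr => // p p_pr.
rewrite big_ord_recl big_ord_recr /= expr1n mul1r bin0 mulr1n subnn mul1r binn mulr1n.
move=> e; have {e} : T ^+ p.+1 =
    - \sum_(i < p) (1 ^+ (p.+1 - i.+1) * T ^+ i.+1) *+ 'C(p.+1, i.+1).
  by apply/eqP; rewrite -addr_eq0 addrC; apply/eqP/(addrI 1); rewrite addr0 -[RHS]e.
move=> ->; have : forall i : 'I_p, exists k, 'C(p.+1, i.+1) = (k * p.+1)%N.
  by move=> i; apply/dvdnP; rewrite prime_dvd_bin //= ltnS.
move=> /choice[k kE]; exists (- \sum_(i < p) T ^+ i.+1 * (k i)%:R).
rewrite mulrN big_distrr /=; congr (- _); apply: eq_bigr => i _.
by rewrite kE expr1n mul1r -mulr_natl natrM; ring.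
Qed.

Variables (x : G).
Hypothesis xG : forall g, exists n, g = (x ^+ n)%g.

(** A group element x^n is 1 modulo x - 1, so every a is congruent to its
    augmentation. *)
Lemma aug_kernel a : exists z, a = gcst (aug a) + (gelt x - 1) * z.
Proof.
have /choice[z zE] g : exists z, gelt g = 1 + (gelt x - 1) * z.
  by have [n ->] := xG g; exists (\sum_(i < n) gelt x ^+ i); rewrite -subrX1 subrKC geltX.
exists (\sum_g gcst (a g) * z g).
have -> : gcst (aug a) = \sum_g gcst (a g).
  by apply: (big_morph gcst gcstD); apply/ffunP => h; rewrite !ffunE mul0r.
rewrite {1}[a]grpringE mulr_sumr -big_split /=; apply: eq_bigr => g _.
by rewrite zE mulrDr mulr1 !mulrA gcst_comm.
Qed.

Definition gsum : grpring R G := [ffun=> 1].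

Lemma gelt_gsum : (gelt x - 1) * gsum = 0.
Proof.
rewrite mulrBl mul1r.
have -> : gelt x * gsum = gsum by apply/ffunP => h; rewrite gelt_mulE !ffunE.
by rewrite subrr.
Qed.

(** If x a = a then the coefficients of a are constant on G. *)
Lemma gelt_ann a : (gelt x - 1) * a = 0 -> a = gcst (a 1%g) * gsum.
Proof.
rewrite mulrBl mul1r => /subr0_eq xa.
have xE h : a (x^-1 * h)%g = a h by rewrite -gelt_mulE xa.
apply/ffunP => h; rewrite gcst_mulE ffunE mulr1; have [n ->] := xG h.
by elim: n => [|n IH] //; rewrite expgS -[LHS]xE mulKg.
Qed.

End GroupRing.

(** The group ring of an abelian group as a commutative ring; its operations are
    those of grpring by conversion. *)
Definition comgrpring (R : comPzRingType) (G : finGroupType)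
    (cG : abelian [set: G]%SET) : comPzRingType :=
  HB.pack (grpring R G)
    (GRing.PzRing_hasCommutativeMul.Build (grpring R G) (grpring_mulC cG)).

(** All the congruences modulo T are read off by applying the augmentation,
    which vanishes on the multiples of T. *)
Lemma comgrpring_fibre_ring (R : comPzRingType) (p : nat) (G : finGroupType)
    (cG : abelian [set: G]%SET) (x : G) : prime p -> #|G| = p ->
    (forall g, exists n, g = (x ^+ n)%g) ->
    (forall c : R, p%:R * c = 0 -> c = 0) ->
    (forall k (c : R), exists i d, c = i%:R + p%:R ^+ k * d) ->
    (forall k i (c : R), i%:R = p%:R ^+ k * c -> (p ^ k %| i)%N) ->
  @fibre_ring (comgrpring R cG) p (gelt R x - 1) (gsum R G).
Proof.
move=> p_pr oG xG R_torsion R_digits R_dvd.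
pose T : grpring R G := gelt R x - 1.
have augT (z : grpring R G) : aug (T * z) = 0.
  rewrite augM (_ : aug T = 0) ?mul0r //; apply: (addIr (aug (1 : grpring R G))).
  by rewrite -augD subrK add0r aug_gelt -gelt1 aug_gelt.
have augpX k (a : grpring R G) : aug (p%:R ^+ k * a) = p%:R ^+ k * aug a.
  by rewrite -natrX augM aug_nat natrX.
have pE (a : grpring R G) h : (p%:R * a) h = p%:R * a h.
  by rewrite -gcst_natE gcst_mulE.
split.
- exact: gelt_gsum.
- by move=> a /(gelt_ann xG) ->; exists (gcst G (a 1%g)).
- have [z ->] := aug_kernel xG (gsum R G); exists z.
  rewrite -[p%:R]gcst_natE; congr (gcst _ _ + _).
  by rewrite /aug; under eq_bigr do rewrite ffunE; rewrite sumr_const -oG cardT.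
- apply: unipotent_expp => //.
  have -> : 1 + (gelt R x - 1) = gelt R x by rewrite subrKC.
  have : (x ^+ p)%g = 1%g by rewrite -oG -cardsT; apply/expg_cardG/finset.in_setT.
  by move=> xp; rewrite -[LHS]geltX xp.
- by move=> a pa; apply/ffunP => h; rewrite ffunE; apply: R_torsion; rewrite -pE pa ffunE.
- move=> a Ta.
  have x1 : (1%g == x) = false.
    apply/eqP => x1; move: p_pr; rewrite -oG.
    rewrite (fintype.eq_card1 (x := 1%g)) // => g; have [n ->] := xG g.
    by rewrite -x1 expg1n !inE eqxx.
  have : (p%:R ^+ 1 * - (a 1%g)) = 1%:R :> R.
    rewrite expr1 mulrN -pE -[p%:R * a]Ta !ffunE x1.
    by rewrite eqxx sub0r opprK.
  move=> /esym/R_dvd; rewrite expn1 dvdn1 => /eqP p1.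
  by move: p_pr; rewrite p1.
- move=> k a; have [z aE] := aug_kernel xG a.
  have [i [c cE]] := R_digits k (aug a).
  exists i, (gcst G c), z.
  by rewrite {1}aE cE gcstD gcst_natE -natrX gcstM gcst_natE natrX.
- move=> k i y z /(congr1 (fun a : grpring R G => aug a)) e.
  apply: (R_dvd k i (aug (y : grpring R G))).
  rewrite -[i%:R](@aug_nat R G) -augpX; apply: etrans e _.
  by rewrite [LHS]augD augT addr0.
- move=> y z /(congr1 (fun a : grpring R G => aug a)) e.
  have [z' yE] := aug_kernel xG y; exists z'; rewrite {1}yE.
  suff -> : aug y = 0 by rewrite -[LHS]/(gcst G 0%:R + _) gcst_natE add0r.
  apply: R_torsion; rewrite -[p%:R](@aug_nat R G) -augM.
  by apply: etrans e _; apply: augT.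
Qed.

(** * From the count to the zeta function *)

Section Convergence.
Variable R : realType.
Implicit Types (r : R) (t : R[i]).

(** n r^n is at most 1 + r + ... + r^(n-1). *)
Lemma natX_geometric_bound r n : 0 <= r <= 1 -> n%:R * r ^+ n * (1 - r) <= 1 - r ^+ n.
Proof.
move=> /andP[r0 r1]; elim: n => [|n IH]; first by rewrite !mul0r expr0 subrr.
rewrite exprS -natr1.
have rn1 : r * r ^+ n <= 1 by rewrite -exprS exprn_ile1.
have : 0 <= (1 - r) * (1 - r * r ^+ n) by rewrite mulr_ge0 // subr_ge0.
have := ler_wpM2l r0 IH; lra.
Qed.

(** With w the square root of r, n r^n = (n w^n) w^n is at most w^n / (1 - w). *)
Lemma cvg_natX_geometric r : 0 <= r < 1 -> (fun n => n%:R * r ^+ n) @ \oo --> (0 : R).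
Proof.
move=> /andP[r0 r1]; set w := Num.sqrt r.
have w0 : 0 <= w := sqrtr_ge0 r.
have w1 : w < 1 by rewrite -sqrtr1 ltr_sqrt.
have ww : r = w * w by rewrite -expr2 sqr_sqrtr.
apply: (@squeeze_cvgr _ _ _ _ (cst 0) ((1 - w)^-1 *: GRing.exp w)).
- near=> n; apply/andP; split; first by rewrite mulr_ge0 // exprn_ge0.
  rewrite ww exprMn mulrA /= ler_wpM2r ?exprn_ge0 // -[_^-1]mul1r.
  rewrite ler_pdivlMr ?subr_gt0 //.
  have := @natX_geometric_bound w n; rewrite w0 ltW // => /(_ isT)/le_trans; apply.
  by rewrite gerBl exprn_ge0.
- exact: cvg_cst.
- rewrite -(scaler0 _ (1 - w)^-1); apply: cvgZl_tmp; apply: cvg_expr.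
  by rewrite ger0_norm.
Unshelve. all: by end_near. Qed.

Lemma normc_real t : exists2 r, 0 <= r & `|t| = r%:C%C.
Proof.
rewrite normc_def.
by exists (Num.sqrt (complex.Re t ^+ 2 + complex.Im t ^+ 2)); rewrite ?sqrtr_ge0.
Qed.

(** A positive complex number is a positive real, so convergence to 0 in the
    norm of R[i] is convergence to 0 of the real moduli. *)
Lemma cvgc_real (u : nat -> R[i]) (v : nat -> R) :
  (forall n, `|u n| = (v n)%:C%C) -> v @ \oo --> 0 -> (u : nat -> R[i]^o) @ \oo --> 0.
Proof.
move=> uv v0; apply/cvgr0Pnorm_lt => e; rewrite ltcE /= => /andP[/eqP ei er].
have eE : e = (complex.Re e)%:C%C by case: e ei er => a b /= ->.
move/cvgr0Pnorm_lt: v0 => /(_ _ er); apply: filterS => n; rewrite uv eE ltcR.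
by move=> /(le_lt_trans _); apply; apply: ler_norm.
Qed.

Lemma cvgc_expr t : `|t| < 1 -> (fun n => t ^+ n : R[i]^o) @ \oo --> 0.
Proof.
have [r r0 tr] := normc_real t; rewrite tr -[1]/(1%:C%C) ltcR => r1.
apply: (@cvgc_real _ (GRing.exp r)) => [n|].
  by rewrite normrX tr rmorphXn.
by apply: cvg_expr; rewrite ger0_norm.
Qed.

Lemma cvgc_natX t : `|t| < 1 -> (fun n => n%:R * t ^+ n : R[i]^o) @ \oo --> 0.
Proof.
have [r r0 tr] := normc_real t; rewrite tr -[1]/(1%:C%C) ltcR => r1.
apply: (@cvgc_real _ (fun n => n%:R * r ^+ n)) => [n|].
  by rewrite normrM normr_nat normrX tr rmorphM rmorphXn rmorph_nat.
by apply: cvg_natX_geometric; rewrite r0.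
Qed.

Section Cpow.
Variable x : R.
Hypothesis x_gt0 : 0 < x.

Lemma cpowD (z w : R[i]) : cpow x (z + w) = cpow x z * cpow x w.
Proof.
case: z w => [a b] [c d]; rewrite /cpow /= powRD; last by rewrite (gt_eqF x_gt0) implybT.
rewrite mulrDl cosD sinD; apply/eqP; rewrite eq_complex /=.
by apply/andP; split; apply/eqP; ring.
Qed.

Lemma cpow0 : cpow x 0 = 1.
Proof.
rewrite /cpow /= powRr0 mul0r cos0 sin0; apply/eqP; rewrite eq_complex /=.
by rewrite !(mulr1, mulr0, subr0, addr0) !eqxx.
Qed.

Lemma cpow1 : cpow x 1 = x%:C%C.
Proof.
rewrite /cpow /= powRr1 ?ltW // mul0r cos0 sin0.
apply/eqP; rewrite eq_complex /=.
by rewrite !(mulr1, mulr0, mul0r, subr0, addr0) !eqxx.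
Qed.

Lemma cpowX z n : cpow x (n%:R * z) = cpow x z ^+ n.
Proof.
elim: n => [|n IH]; first by rewrite mul0r cpow0.
by rewrite -natr1 mulrDl mul1r cpowD IH exprSr.
Qed.

Lemma cpow_norm z : `|cpow x z| = (x `^ complex.Re z)%:C%C.
Proof.
case: z => a b; rewrite /cpow normrM; set y := (b * ln x).
have -> : `|(cos y +i* sin y)%C| = 1 by rewrite normc_def /= cos2Dsin2 sqrtr1.
by rewrite mulr1 normc_def /= expr0n addr0 sqrtr_sqr ger0_norm ?powR_ge0.
Qed.

End Cpow.

(** The second differences of b vanish from index 1 on, so multiplication by
    (1 - t)^2 leaves the first three terms and the two boundary terms. *)
Lemma zeta_partial (K : comPzRingType) (p : nat) (b : nat -> nat) (t : K) m :
  b 0%N = 1%N -> (forall n, b n.+1 = (1 + n * p)%N) ->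
  (1 - t) ^+ 2 * (\sum_(0 <= k < m.+2) (b k)%:R * t ^+ k)
   = 1 - t + p%:R * t ^+ 2
     - t ^+ 2 * ((1 + p%:R - t) * t ^+ m + p%:R * (1 - t) * (m%:R * t ^+ m)).
Proof.
move=> b0 bS; elim: m => [|m IH].
  by rewrite !big_nat_recl // big_geq // b0 !bS !natrD; ring.
by rewrite big_nat_recr // /= mulrDr IH bS natrD natrM -!natr1 !exprS; ring.
Qed.

Lemma zeta_cvg (p : nat) (b : nat -> nat) t : `|t| < 1 ->
  b 0%N = 1%N -> (forall n, b n.+1 = (1 + n * p)%N) ->
  series (fun n => (b n)%:R * t ^+ n : R[i]^o) @ \oo -->
    ((1 - t + p%:R * t ^+ 2) / (1 - t) ^+ 2 : R[i]^o).
Proof.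
move=> t1 b0 bS; rewrite -(cvg_shiftn 2).
have t_neq1 : 1 - t != 0.
  by rewrite subr_eq0; apply: contraTneq t1 => <-; rewrite normr1 ltxx.
pose c1 := - (t ^+ 2 / (1 - t) ^+ 2 * (1 + p%:R - t)).
pose c2 := - (t ^+ 2 / (1 - t) ^+ 2 * (p%:R * (1 - t))).
pose L := (1 - t + p%:R * t ^+ 2) / (1 - t) ^+ 2.
have Lcvg : (fun n => L + (c1 * t ^+ n + c2 * (n%:R * t ^+ n)) : R[i]^o) @ \oo -->
    (L + (c1 * 0 + c2 * 0) : R[i]^o).
  apply: cvgD; first exact: cvg_cst.
  by apply: cvgD; apply: cvgMl_tmp; [exact: cvgc_expr | exact: cvgc_natX].
rewrite !mulr0 !addr0 in Lcvg; apply: cvg_trans Lcvg.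
apply: near_eq_cvg; apply: nearW => n; rewrite /series /= addn2.
have /(canRL (mulKf (expf_neq0 2 t_neq1))) -> := zeta_partial t n b0 bS.
by rewrite /L /c1 /c2; field.
Qed.

End Convergence.

Lemma zeta_coef (p : nat) (b : nat -> nat) n :
  b 0%N = 1%N -> (forall n, b n.+1 = (1 + n * p)%N) ->
  \sum_(i < n.+1) ((1 - 'X) ^+ 2 : {poly int})`_i * (b (n - i)%N)%:R
        = (1 - 'X + p%:R *: 'X^2 : {poly int})`_n.
Proof.
move=> b0 bS.
have cE i : ((1 - 'X) ^+ 2 : {poly int})`_i =
    (i == 0%N)%:R - (i == 1%N)%:R *+ 2 + (i == 2)%:R.
  by rewrite sqrrB expr1n mul1r !coefE.
rewrite !coefE; under eq_bigr do rewrite cE.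
case: n => [|[|[|n]]]; rewrite !big_ord_recl ?big_ord0 /= /bump /=
  !(addn0, add1n, subn0, subSS, b0, bS); last first.
  rewrite big1 => [|i _]; last by rewrite mul0rn subr0 addr0 mul0r.
  by rewrite -!natr1 !natrM -!natr1; ring.
all: by rewrite -?natr1 ?natrM; ring.
Qed.

Theorem mainTheorem4 (p : nat) (G : finGroupType)
    (p_prime : prime p) (G_cyclic : cyclic [set: G]%SET) (card_G : #|G| = p) :
  let L : lmodType (grpring (padic p) G) := (grpring (padic p) G)^o in
  let b (n : nat) : nat := nsubmods L (p ^ n) in
  [/\ forall n : nat, finite_set (submods L (p ^ n)),
      (* formal reading, coefficientwise in 'X = p^-s *)
      forall n : nat,
        \sum_(i < n.+1) ((1 - 'X) ^+ 2 : {poly int})`_i * (b (n - i)%N)%:R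
        = (1 - 'X + p%:R *: 'X^2 : {poly int})`_n
    & (* analytic reading *)
      forall (R : realType) (s : R[i]), 0 < complex.Re s ->
        let q (z : R[i]) : R[i] := cpow p%:R z in
        series (fun n => (b n)%:R * q (- (n%:R * s)) : R[i]^o) @ \oo -->
          ((1 - q (- s) + q (1 - 2%:R * s)) / (1 - q (- s)) ^+ 2 : R[i]^o)].
Proof.
move=> L b.
have [x Gx] := cyclicP G_cyclic.
have xG g : exists n, g = (x ^+ n)%g by apply/cycleP; rewrite -Gx finset.in_setT.
have AX := comgrpring_fibre_ring (cyclic_abelian G_cyclic) p_prime card_G xG
  (padic_torsion p_prime) (padic_digits p_prime) (@padic_nat_dvd p).
have sub1 : submods L (p ^ 0) = [set setT] :=
  submods1 (comgrpring (padic p) (cyclic_abelian G_cyclic)).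
have subS n : (submods L (p ^ n.+1) #= `I_(n * p).+1)%card := card_submods p_prime AX n.
have b0 : b 0%N = 1%N by rewrite /b /nsubmods sub1 fset_set1 cardfs1.
have bS n : b n.+1 = (1 + n * p)%N by rewrite /b /nsubmods (card_fset_set (subS n)).
split=> [[|n]|n|R s s_gt0 q].
- by rewrite sub1; apply: finite_set1.
- by apply/finite_setP; exists (n * p).+1.
- exact: zeta_coef.
have p_gt0 : 0 < p%:R :> R by rewrite ltr0n prime_gt0.
have q_lt1 : `|q (- s)| < 1.
  rewrite /q cpow_norm -[X in _ < X]/(1%:C%C) ltcR.
  rewrite /powR gt_eqF // expR_lt1 raddfN /= mulNr oppr_lt0.
  by rewrite mulr_gt0 // ln_gt0 // ltr1n prime_gt1.
have -> : (fun n => (b n)%:R * q (- (n%:R * s))) = (fun n => (b n)%:R * q (- s) ^+ n).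
  by apply/funext => n; rewrite -mulrN /q cpowX.
have -> : q (1 - 2%:R * s) = p%:R * q (- s) ^+ 2.
  by rewrite /q cpowD // cpow1 // -mulrN cpowX // rmorph_nat.
exact: zeta_cvg.
Qed.
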